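(* Let $q\in\mathbb{C}$ with $0<|q|<1$, let $r\in\mathbb{N}$ (that is, $r\ge 1$), let $s\in\mathbb{C}$, and let $a,b\in\mathbb{N}$ with $a\equiv 1 \pmod 2$ and $b\equiv 1\pmod 2$. Let $x\in\mathbb{R}$ be such that all the values of the multiple $q$-Euler zeta functions below are defined, i.e. none of the numbers $bx+\frac{b}{a}(j_1+\cdots+j_r)$ with $0\le j_1,\dots,j_r\le a-1$, and none of the numbers $ax+\frac{a}{b}(j_1+\cdots+j_r)$ with $0\le j_1,\dots,j_r\le b-1$, belongs to $\{0,-1,-2,\dots\}$. Then \begin{align*} & [2]_{q^{b}}^{r}\,[b]_{q}^{s}\sum_{j_{1},\ldots,j_{r}=0}^{a-1}(-1)^{\sum_{l=1}^{r}j_{l}}\,q^{b\sum_{l=1}^{r}j_{l}}\,\zeta_{q^{a},r}\left(s,\,bx+\frac{b}{a}(j_{1}+\cdots+j_{r})\right)\\ ={} & [2]_{q^{a}}^{r}\,[a]_{q}^{s}\sum_{j_{1},\ldots,j_{r}=0}^{b-1}(-1)^{\sum_{l=1}^{r}j_{l}}\,q^{a\sum_{l=1}^{r}j_{l}}\,\zeta_{q^{b},r}\left(s,\,ax+\frac{a}{b}(j_{1}+\cdots+j_{r})\right). \end{align*}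
   Context: Powers of $q$: fix a logarithm $\log q$ of $q$ and put $q^{y}=\exp(y\log q)$ for $y\in\mathbb{R}$; for $c\in\mathbb{N}$, real powers of $q^{c}$ are understood as $(q^{c})^{y}=q^{cy}$. $q$-numbers: for $c\in\mathbb{N}$ and $y\in\mathbb{R}$, $[y]_{q^{c}}=\frac{1-q^{cy}}{1-q^{c}}$; in particular $[y]_q=\frac{1-q^{y}}{1-q}$ and $[cy]_q=[c]_q\,[y]_{q^c}$. Complex powers of $q$-numbers: for real $y\neq 0$, $[y]_q^{s}=\exp(s\,\mathrm{Log}[y]_q)$ with $\mathrm{Log}$ the principal logarithm, and powers in base $q^c$ are taken consistently with $[cy]_q=[c]_q[y]_{q^c}$, i.e. $[y]_{q^c}^{s}=\exp\big(s(\mathrm{Log}[cy]_q-\mathrm{Log}[c]_q)\big)$, so that $[c]_q^{s}\,[y]_{q^c}^{s}=[cy]_q^{s}$. (For $0<q<1$, with the real logarithm of $q$, these are all principal powers.) Multiple $q$-Euler zeta function: for $c\in\mathbb{N}$, $s\in\mathbb{C}$, and $y\in\mathbb{R}$ with $y\ne 0,-1,-2,\ldots$, $$\zeta_{q^{c},r}(s,y)=[2]_{q^{c}}^{r}\sum_{m_{1},\ldots,m_{r}=0}^{\infty}\frac{(-q^{c})^{m_{1}+\cdots+m_{r}}}{[m_{1}+\cdots+m_{r}+y]_{q^{c}}^{s}},$$ where $(-q^c)^{m}=(-1)^m q^{cm}$ and $[2]_{q^c}=1+q^c$. *)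

(* Defs.v *)
From mathcomp Require Import all_boot all_order all_algebra.
From mathcomp Require Import boolp classical_sets reals topology normedtype.
From mathcomp Require Import sequences exp trigo.
From mathcomp Require Import complex.
From mathcomp Require Import showcase.summability.

Set Implicit Arguments.
Unset Strict Implicit.
Unset Printing Implicit Defensive.
Import Order.TTheory GRing.Theory Num.Theory.
Import numFieldNormedType.Exports.
Local Open Scope ring_scope.
Local Open Scope complex_scope.

Definition cexp (R : realType) (z : R[i]) : R[i] :=
  (expR (complex.Re z))%:C * (cos (complex.Im z) +i* sin (complex.Im z)).

(* Principal argument, in ]-pi, pi]; meaningful for z != 0. *)
Definition carg (R : realType) (z : R[i]) : R :=
  let t := acos (complex.Re z / complex.Re `|z|) in
  if 0 <= complex.Im z then t else - t.

(* Principal logarithm; only applied to nonzero arguments below. *)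
Definition cLog (R : realType) (z : R[i]) : R[i] :=
  ln (complex.Re `|z|) +i* carg z.

(* In what follows the base q is represented by the chosen logarithm lq,
   i.e. q = cexp lq; base q ^ c then has the logarithm c * lq. *)
Definition qpow (R : realType) (lq : R[i]) (y : R) : R[i] := cexp (y%:C * lq).

(* The q-number [y]_{q^c}. *)
Definition qnum (R : realType) (lq : R[i]) (c : nat) (y : R) : R[i] :=
  (1 - qpow lq (c%:R * y)) / (1 - qpow lq c%:R).

(* z ^ s with the principal logarithm. *)
Definition cpow (R : realType) (z s : R[i]) : R[i] := cexp (s * cLog z).

(* [y]_{q^c} ^ s.  The branch is the one for which
   [c]_q ^ s * [y]_{q^c} ^ s = [c y]_q ^ s, which need not be the principal
   power of [y]_{q^c} when q is not a positive real. *)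
Definition qnum_pow (R : realType) (lq : R[i]) (c : nat) (y : R) (s : R[i]) :
    R[i] :=
  cexp (s * (cLog (qnum lq 1 (c%:R * y)) - cLog (qnum lq 1 c%:R))).

(* zeta_{q^c, r} (s, y).  The multiple series over (m_1, ..., m_r) is the
   unordered sum: the limit of the partial sums along the finite subsets of
   nat ^ r directed by inclusion. *)
Definition qEuler_zeta (R : realType) (lq : R[i]) (c r : nat)
    (s : R[i]) (y : R) : R[i] :=
  qnum lq c 2 ^+ r *
  sum (fun m : {ffun 'I_r -> nat} =>
    let M := (\sum_(l < r) m l)%N in
    (- qpow lq c%:R) ^+ M / qnum_pow lq c (M%:R + y) s : (R[i])^o).

(* Main.v *)
Require Import Defs.
From mathcomp Require Import all_boot all_order all_algebra.
From mathcomp Require Import finmap.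
From mathcomp Require Import boolp classical_sets reals topology normedtype.
From mathcomp Require Import sequences exp trigo.
From mathcomp Require Import complex.
From mathcomp Require Import showcase.summability.
From mathcomp Require Import ring.

(** Why the identity holds.  Write |m| for m_1 + ... + m_r and put
      G(N) = (-q)^N / [N + abx]_q^s.
    The branch of the powers in base q^a is chosen so that
    [a]_q^s [y]_(q^a)^s = [ay]_q^s.  Multiplying the term of index m of the
    zeta series at y = bx + (b/a)|j| by [b]_q^s (-1)^|j| q^(b|j|) therefore
    gives [a]_q^s [b]_q^s G(a|m| + b|j|): here a and b odd makes the sign
    (-1)^(|m|+|j|) equal to (-1)^(a|m|+b|j|) ([qEuler_term_scale]).  Up to a
    factor symmetric in a and b, the left-hand side is thus
      sum over j in [0,a)^r and m in N^r of G(a|m| + b|j|),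
    and the right-hand side is the same expression with a and b exchanged.

    Both are equal because writing m = bn + i with i in [0,b)^r turns the
    argument of G into ab|n| + a|i| + b|j|.  This is done on finite sums only:
    m is restricted to the cube [0,bk)^r on the left and to [0,ak)^r on the
    right, both of which come from n in [0,k)^r ([cube_sum_symmetric]), and
    then k tends to infinity.

    The limit along cubes is the unordered sum of the definition as soon as
    the latter converges ([cvg_cube_sum]).  Convergence is absolute: [y]_q
    tends to the nonzero number 1/(1-q) when y tends to +oo, so Log [y]_q is
    bounded along the arguments in the series ([cLog_bounded]), hence so are
    the denominators and their inverses, and the terms are dominated by a
    geometric family K t^|m| with t < 1 ([qEuler_term_le]), whose sum over a
    cube is the r-th power of a geometric sum. *)

Set Implicit Arguments.
Unset Strict Implicit.
Unset Printing Implicit Defensive.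
Import Order.TTheory GRing.Theory Num.Theory.
Import numFieldNormedType.Exports.
Local Open Scope ring_scope.
Local Open Scope complex_scope.
Local Open Scope classical_set_scope.
#[local] Existing Instance totally_filter.

(** * The complex exponential *)

Lemma norm_real_complex (R : realType) (x : R) : `|x%:C| = `|x|%:C :> R[i].
Proof. by rewrite normc_def /= expr0n addr0 sqrtr_sqr. Qed.

Lemma cexpD (R : realType) (z w : R[i]) : cexp (z + w) = cexp z * cexp w.
Proof.
case: z w => [x u] [y v]; rewrite /cexp /= expRD cosD sinD.
rewrite rmorphM mulrACA; congr (_ * _).
by apply/eqP; rewrite eq_complex /= [sin u * cos v + _]addrC !eqxx.
Qed.

Lemma cexp0 (R : realType) : cexp 0 = 1 :> R[i].
Proof. by rewrite /cexp /= expR0 cos0 sin0 mul1r. Qed.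

Lemma cexpN (R : realType) (z : R[i]) : cexp (- z) = (cexp z)^-1.
Proof.
have e : cexp z * cexp (- z) = 1 by rewrite -cexpD subrr cexp0.
have z0 : cexp z != 0.
  by apply: contra_eqN e => /eqP ->; rewrite mul0r eq_sym oner_eq0.
by apply: (mulfI z0); rewrite e divff.
Qed.

Lemma cexpMn (R : realType) (z : R[i]) (n : nat) :
  cexp (n%:R * z) = cexp z ^+ n.
Proof.
elim: n => [|n IHn]; first by rewrite mul0r cexp0.
by rewrite exprS -IHn -cexpD mulrSr mulrDl mul1r addrC.
Qed.

Lemma norm_cexp (R : realType) (z : R[i]) :
  `|cexp z| = (expR (complex.Re z))%:C.
Proof.
rewrite normrM norm_real_complex (ger0_norm (expR_ge0 _)) normc_def /=.
by rewrite cos2Dsin2 sqrtr1 mulr1.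
Qed.

(** * Unordered sums of complex families *)

Lemma partial_sumE (T : choiceType) (V : zmodType) (f : T -> V) (A : {fset T}) :
  partial_sum f A = \sum_(t <- A) f t.
Proof. by rewrite big_seq_fsetE. Qed.

Lemma partial_sum_ge0_homo (R : realType) (T : choiceType) (g : T -> R)
    (A B : {fset T}) :
  (forall t, 0 <= g t) -> (A `<=` B)%fset ->
  partial_sum g A <= partial_sum g B.
Proof.
move=> g0 AB; rewrite !partial_sumE [leRHS](big_fsetID _ (mem A)) /=.
have -> : [fset x in B | x \in A]%fset = A.
  by apply/fsetP => t; rewrite !inE /= andbC andb_idr// => /(fsubsetP AB).
by rewrite lerDl sumr_ge0.
Qed.

(** Monotone convergence along the directed set of finite subsets: the limit is
    the supremum of the partial sums. *)
Lemma cvg_partial_sum_ge0 (R : realType) (T : choiceType) (g : T -> R)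
    (B : R) :
  (forall t, 0 <= g t) -> (forall A, partial_sum g A <= B) ->
  exists l : R,
    ((partial_sum g A)%:C : R[i]^o) @[A --> totally] --> (l%:C : R[i]^o).
Proof.
move=> g0 gB; exists (sup (range (partial_sum g))).
have ubS : has_ubound (range (partial_sum g)).
  by exists B => _ [A _ <-]; exact: gB.
have supS : has_sup (range (partial_sum g)).
  by split=> //; exists (partial_sum g fset0); exists fset0.
apply/cvgrPdist_lt => -[e e'] /=; rewrite ltcE /= => /andP[/eqP -> e0].
have [_ [A _ <-] Ae] := sup_adherent e0 supS.
exists A => //= C AC; rewrite -rmorphB norm_real_complex ltcR.
rewrite ger0_norm ?subr_ge0; last by apply: ub_le_sup => //; exists C.
by rewrite ltrBlDr -ltrBlDl (lt_le_trans Ae)// partial_sum_ge0_homo.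
Qed.

(** A family dominated by a real family g with bounded partial sums is summable.
    Its real and imaginary parts p satisfy |p| <= g, and p = (g + p) - g is a
    difference of two nonnegative families, to which monotone convergence
    applies. *)
Lemma cvg_partial_sum (R : realType) (T : choiceType) (f : T -> R[i])
    (g : T -> R) (B : R) :
  (forall t, `|f t| <= (g t)%:C) -> (forall A, partial_sum g A <= B) ->
  cvg ((partial_sum f A : R[i]^o) @[A --> totally]).
Proof.
move=> fg gB.
have ReIm_le t : `|complex.Re (f t)| <= g t /\ `|complex.Im (f t)| <= g t.
  have: Num.sqrt (complex.Re (f t) ^+ 2 + complex.Im (f t) ^+ 2) <= g t.
    by rewrite -lecR -normc_def.
  split; apply: le_trans (_ : Num.sqrt _ <= _); try eassumption;
    by rewrite -sqrtr_sqr ler_wsqrtr ?lerDl ?lerDr ?sqr_ge0.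
have g0 t : 0 <= g t by case: (ReIm_le t) => + _; exact: le_trans.
have cvgp (p : T -> R) : (forall t, `|p t| <= g t) ->
    exists l : R,
      ((partial_sum p A)%:C : R[i]^o) @[A --> totally] --> (l%:C : R[i]^o).
  move=> pg.
  have [||l cl] := @cvg_partial_sum_ge0 R T (fun t => g t + p t) (B + B).
  - move=> t; rewrite -lerBlDl sub0r lerNl; apply: le_trans (pg t).
    by rewrite -normrN ler_norm.
  - move=> A; rewrite partial_sumE big_split/= -!partial_sumE lerD//.
    rewrite (le_trans _ (gB A))// !partial_sumE ler_sum// => t _.
    by rewrite (le_trans (ler_norm _)).
  have [l' cl'] := cvg_partial_sum_ge0 g0 gB.
  exists (l - l').
  rewrite rmorphB; apply: cvg_trans (cvgB cl cl').
  apply: near_eq_cvg; apply: nearW => A /=.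
  rewrite -[LHS](rmorphB (real_complex R)); congr (_%:C).
  rewrite !partial_sumE -sumrB.
  by apply: eq_bigr => t _; rewrite addrC addKr.
have [l cl] := cvgp (fun t => complex.Re (f t)) (fun t => proj1 (ReIm_le t)).
have [l' cl'] := cvgp (fun t => complex.Im (f t)) (fun t => proj2 (ReIm_le t)).
apply/cvg_ex; exists (l%:C + 'i%C * l'%:C : R[i]^o).
have ci := cvgMl_tmp (FF := totally_filter) (a := 'i%C) cl'.
apply: cvg_trans (cvgD cl ci).
apply: near_eq_cvg; apply: nearW => A /=.
transitivity ((partial_sum (fun t => complex.Re (f t)) A)%:C
  + 'i%C * (partial_sum (fun t => complex.Im (f t)) A)%:C) => //.
rewrite !partial_sumE !rmorph_sum mulr_sumr -big_split /=.
by apply: eq_bigr => t _; rewrite -complexE.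
Qed.

(** * Summation over r-tuples of naturals along cubes *)

Definition cube (r k : nat) : {fset {ffun 'I_r -> nat}} :=
  [fset [ffun l => m l : nat] | m : {ffun 'I_r -> 'I_k} in predT]%fset.

Lemma partial_sum_cube (V : zmodType) (r k : nat)
    (f : {ffun 'I_r -> nat} -> V) :
  partial_sum f (cube r k) =
  \sum_(m : {ffun 'I_r -> 'I_k}) f [ffun l => m l : nat].
Proof.
rewrite partial_sumE big_imfset /=; last first.
  move=> m n _ _ /ffunP mn; apply/ffunP => l; apply: val_inj.
  by have := mn l; rewrite !ffunE.
by rewrite big_enum.
Qed.

Lemma mem_cube (r k : nat) (m : {ffun 'I_r -> nat}) :
  (forall l, (m l < k)%N) -> m \in cube r k.
Proof.
move=> mk; apply/imfsetP; exists [ffun l => Ordinal (mk l)] => //=.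
by apply/ffunP => l; rewrite !ffunE.
Qed.

Lemma fset_sub_cube (r : nat) (A : {fset {ffun 'I_r -> nat}}) :
  exists N, forall k, (N <= k)%N -> (A `<=` cube r k)%fset.
Proof.
exists (\max_(m <- A) \max_(l < r) m l).+1 => k Nk.
apply/fsubsetP => m mA; apply: mem_cube => l; apply: leq_trans Nk.
rewrite ltnS (leq_trans (leq_bigmax l))//.
exact: (@leq_bigmax_seq _ (enum_fset A) xpredT
  (fun m : {ffun 'I_r -> nat} => \max_(l < r) m l)%N m mA isT).
Qed.

(** Every finite set of r-tuples lies in a cube, so a limit along finite subsets
    can be computed along cubes. *)
Lemma cvg_cube (r : nat) : cube r k @[k --> \oo] --> totally.
Proof.
move=> P [A _ AP]; have [N NA] := fset_sub_cube A.
by exists N => // k /= Nk; apply/AP/NA.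
Qed.

(** The sum over the cube factors as the r-th power of a geometric sum. *)
Lemma sum_geometric_cube_le (R : realType) (t : R) (r k : nat) :
  0 <= t < 1 ->
  \sum_(m : {ffun 'I_r -> 'I_k}) t ^+ (\sum_(l < r) m l)%N <= (1 - t)^-1 ^+ r.
Proof.
move=> /andP[t0 t1].
have -> : \sum_(m : {ffun 'I_r -> 'I_k}) t ^+ (\sum_(l < r) m l)%N =
    (\sum_(i < k) t ^+ i) ^+ r.
  rewrite -[RHS](_ : \prod_(l < r) \sum_(i < k) t ^+ i = _); last first.
    by rewrite prodr_const card_ord.
  by rewrite bigA_distr_bigA; apply: eq_bigr => m _; rewrite expr_sum.
rewrite lerXn2r ?nnegrE ?invr_ge0 ?subr_ge0 ?(ltW t1)//.
  by rewrite sumr_ge0// => i _; rewrite exprn_ge0.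
have t10 : 0 < 1 - t by rewrite subr_gt0.
rewrite -[leRHS]mul1r ler_pdivlMr// mulrC -opprB mulNr -subrX1 opprB.
by rewrite lerBlDr lerDl exprn_ge0.
Qed.

(** This is the only access to the unordered sum needed below: a function of
    |m| dominated by a geometric sequence may be summed over r-tuples by
    exhausting them with cubes. *)
Lemma cvg_cube_sum (R : realType) (r : nat) (h : nat -> R[i]) (K t : R) :
  0 <= t < 1 -> (forall n, `|h n| <= (K * t ^+ n)%:C) ->
  (\sum_(m : {ffun 'I_r -> 'I_k}) h (\sum_(l < r) m l)%N : R[i]^o) @[k --> \oo]
  --> (sum (fun m : {ffun 'I_r -> nat} => h (\sum_(l < r) m l)%N : R[i]^o)).
Proof.
move=> t01 hK; have K0 : 0 <= K.
  by have := le_trans (normr_ge0 _) (hK 0); rewrite expr0 mulr1 ler0c.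
pose F (m : {ffun 'I_r -> nat}) : R[i] := h (\sum_(l < r) m l)%N.
pose g (m : {ffun 'I_r -> nat}) : R := K * t ^+ (\sum_(l < r) m l)%N.
have g0 m : 0 <= g m by rewrite mulr_ge0 ?exprn_ge0//; case/andP: t01.
have weight_cube k (m : {ffun 'I_r -> 'I_k}) :
    (\sum_(l < r) [ffun l => m l : nat] l = \sum_(l < r) m l)%N.
  by apply: eq_bigr => l _; rewrite ffunE.
have gB A : partial_sum g A <= K * (1 - t)^-1 ^+ r.
  have [N /(_ N (leqnn N)) AN] := fset_sub_cube A.
  rewrite (le_trans (partial_sum_ge0_homo g0 AN))// partial_sum_cube.
  rewrite -mulr_sumr ler_wpM2l//.
  under eq_bigr do rewrite weight_cube.
  exact: sum_geometric_cube_le.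
have cF : cvg ((partial_sum F A : R[i]^o) @[A --> totally]).
  by apply: cvg_partial_sum gB => m; exact: hK.
apply: cvg_trans (cvg_comp _ _ (@cvg_cube r) cF).
apply: near_eq_cvg; apply: nearW => k /=.
by rewrite partial_sum_cube; apply: eq_bigr => m _; rewrite /F weight_cube.
Qed.

(** Coordinatewise Euclidean division m = b n + i identifies [0,bk)^r with
    [0,b)^r * [0,k)^r. *)
Lemma sum_ffun_split (V : zmodType) (r b k : nat) (F : nat -> V) :
  (0 < b)%N ->
  \sum_(m : {ffun 'I_r -> 'I_(b * k)}) F (\sum_(l < r) m l)%N =
  \sum_(i : {ffun 'I_r -> 'I_b}) \sum_(n : {ffun 'I_r -> 'I_k})
    F (b * \sum_(l < r) n l + \sum_(l < r) i l)%N.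
Proof.
move=> b0; rewrite pair_big /=.
have ltbk (i : 'I_b) (n : 'I_k) : (b * n + i < b * k)%N.
  by rewrite (leq_trans (_ : _ < b * n.+1)%N) ?leq_mul2l ?(ltn_ord n) ?orbT//
     mulnS addnC ltn_add2r.
have ltmod (m : 'I_(b * k)) : (m %% b < b)%N by rewrite ltn_mod.
have ltdiv (m : 'I_(b * k)) : (m %/ b < k)%N by rewrite ltn_divLR// [(k * b)%N]mulnC.
pose join (p : {ffun 'I_r -> 'I_b} * {ffun 'I_r -> 'I_k}) :=
  [ffun l => Ordinal (ltbk (p.1 l) (p.2 l))].
pose split (m : {ffun 'I_r -> 'I_(b * k)}) :=
  ([ffun l => Ordinal (ltmod (m l))], [ffun l => Ordinal (ltdiv (m l))]).
have joinK : cancel join split.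
  move=> [i n]; congr (_, _); apply/ffunP => l; rewrite !ffunE;
    apply: val_inj => /=.
    by rewrite mulnC modnMDl modn_small.
  by rewrite mulnC divnMDl// divn_small// addn0.
have splitK : cancel split join.
  move=> m; apply/ffunP => l; rewrite !ffunE; apply: val_inj => /=.
  by rewrite mulnC -divn_eq.
rewrite (reindex join) /=; last first.
  by exists split => ? _; [exact: joinK|exact: splitK].
apply: eq_bigr => -[i n] _; congr F.
by rewrite big_distrr -big_split; apply: eq_bigr => l _; rewrite ffunE.
Qed.

(** Dividing m by b on the left and by a on the right, both sides become the sum
    of G(ab|n| + a|i| + b|j|) over i in [0,b)^r, j in [0,a)^r, n in [0,k)^r.
    The cubes have sides bk and ak precisely so that n has the same range. *)
Lemma cube_sum_symmetric (V : zmodType) (r a b k : nat) (G : nat -> V) :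
  (0 < a)%N -> (0 < b)%N ->
  \sum_(j : {ffun 'I_r -> 'I_a}) \sum_(m : {ffun 'I_r -> 'I_(b * k)})
    G (a * \sum_(l < r) m l + b * \sum_(l < r) j l)%N =
  \sum_(j : {ffun 'I_r -> 'I_b}) \sum_(m : {ffun 'I_r -> 'I_(a * k)})
    G (b * \sum_(l < r) m l + a * \sum_(l < r) j l)%N.
Proof.
move=> a0 b0.
under eq_bigr => j _ do
  rewrite (sum_ffun_split r k (fun N => G (a * N + b * \sum_(l < r) j l)%N) b0).
under [RHS]eq_bigr => j _ do
  rewrite (sum_ffun_split r k (fun N => G (b * N + a * \sum_(l < r) j l)%N) a0).
rewrite exchange_big; apply: eq_bigr => i _; apply: eq_bigr => j _.
apply: eq_bigr => n _; congr G.
by rewrite !mulnDr !mulnA [(b * a)%N]mulnC addnAC.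
Qed.

(** * Boundedness of the logarithms of the q-numbers *)

Lemma norm_complexE (R : realType) (z : R[i]) : `|z| = (complex.Re `|z|)%:C.
Proof. by rewrite RRe_real ?normr_real. Qed.

(** This includes z = 0, where the quotient in the argument is 0 and the value
    is pi/2. *)
Lemma normr_carg_le (R : realType) (z : R[i]) : `|carg z| <= pi.
Proof.
have cosB : -1 <= complex.Re z / complex.Re `|z| <= 1.
  have N0 : 0 <= complex.Re `|z| by rewrite -ler0c -norm_complexE.
  rewrite -ler_norml normrM normfV (ger0_norm N0).
  have [->|Nz] := eqVneq (complex.Re `|z|) 0; first by rewrite invr0 mulr0.
  rewrite ler_pdivrMr ?lt_neqAle ?N0 1?eq_sym ?Nz// mul1r -lecR -norm_complexE.
  exact: normc_ge_Re.
by rewrite /carg; case: ifP => _; rewrite ?normrN ger0_norm ?acos_ge0 ?acos_lepi.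
Qed.

Lemma normr_Complex_le (R : realType) (x y : R) :
  `|x +i* y| <= (`|x| + `|y|)%:C :> R[i].
Proof.
rewrite (_ : x +i* y = x%:C + 'i%C * y%:C); last exact: complexE.
rewrite (le_trans (ler_normD _ _))// normrM !norm_real_complex rmorphD lerD2l.
by rewrite normc_def /= expr0n expr1n add0r sqrtr1 mul1r.
Qed.

(** Only the moduli have to converge, as the argument is always bounded.  The
    limit must be nonzero for the logarithms of the moduli to converge. *)
Lemma cLog_bounded (R : realType) (z : nat -> R[i]) (v : R) : 0 < v ->
  complex.Re `|z n| @[n --> \oo] --> v ->
  exists B : R, forall n, `|cLog (z n)| <= B%:C.
Proof.
move=> v0 zv.
have cln : cvgn (fun n => ln (complex.Re `|z n|) : R^o).
  by apply/cvg_ex; exists (ln v); exact: cvg_comp zv (continuous_ln v0).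
have [B _ /= lnB] := pinfty_ex_gt0 (cvg_seq_bounded cln).
exists (B + pi) => n; apply: le_trans (normr_Complex_le _ _) _.
by rewrite lecR lerD ?normr_carg_le// lnB.
Qed.

Lemma norm_cexpV_le (R : realType) (z : R[i]) (B : R) :
  `|z| <= B%:C -> `|(cexp z)^-1| <= (expR B)%:C.
Proof.
move=> zB; rewrite -cexpN norm_cexp lecR ler_expR.
have : (`|complex.Re (- z)|)%:C <= B%:C.
  by apply: le_trans (normc_ge_Re _) _; rewrite normrN.
by rewrite lecR; apply: le_trans; exact: ler_norm.
Qed.

Lemma norm_qpow (R : realType) (lq : R[i]) (y : R) :
  `|qpow lq y| = (expR (y * complex.Re lq))%:C.
Proof. by rewrite norm_cexp; case: lq => u v /=; rewrite mul0r subr0. Qed.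

Lemma qpow_nat (R : realType) (lq : R[i]) (n : nat) :
  qpow lq n%:R = cexp lq ^+ n.
Proof. by rewrite -cexpMn /qpow rmorph_nat. Qed.

Lemma Re_log_lt0 (R : realType) (lq : R[i]) :
  `|cexp lq| < 1 -> complex.Re lq < 0.
Proof. by rewrite norm_cexp ltcR expR_lt1. Qed.

(** Since |q| < 1, the power q^(c(n+y)) tends to 0, and [c(n+y)]_q tends to
    1/(1-q). *)
Lemma qnum_norm_cvg (R : realType) (lq : R[i]) (c : nat) (y : R) :
  `|cexp lq| < 1 -> (0 < c)%N ->
  complex.Re `|qnum lq 1 (c%:R * (n%:R + y))| @[n --> \oo] -->
    (complex.Re `|1 - cexp lq|)^-1.
Proof.
move=> q1 c0; have lq0 := Re_log_lt0 q1.
pose w n := qpow lq (c%:R * (n%:R + y)).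
have wE n : `|w n| =
    (expR (c%:R * y * complex.Re lq) * expR (c%:R * complex.Re lq) ^+ n)%:C.
  rewrite norm_qpow -expRM_natl -expRD; congr ((expR _)%:C).
  by rewrite mulrDr mulrDl addrC mulrA; congr (_ + _); rewrite -!mulrA mulrCA.
have w0 : complex.Re `|w n| @[n --> \oo] --> 0.
  rewrite (_ : (fun n => _) = fun n => expR (c%:R * y * complex.Re lq) *
      expR (c%:R * complex.Re lq) ^+ n); last by apply/funext => n; rewrite wE.
  rewrite -(mulr0 (expR (c%:R * y * complex.Re lq))).
  apply: cvgMl_tmp; apply: cvg_expr; rewrite ger0_norm ?expR_ge0//.
  by rewrite expR_lt1 pmulr_rlt0 ?ltr0n.
have w1 : complex.Re `|1 - w n| @[n --> \oo] --> (1 : R).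
  apply/cvgrPdist_le => e e0; near=> n.
  have : complex.Re `|w n| <= e.
    near: n; move/cvgrPdist_le : w0 => /(_ _ e0).
    apply: filterS => n; rewrite sub0r normrN; apply: le_trans; exact: ler_norm.
  apply: le_trans.
  have := ler_dist_dist (1 : R[i]) (1 - w n).
  rewrite subKr normr1 (norm_complexE (1 - w n)) (norm_complexE (w n)).
  by rewrite -(rmorph1 (real_complex R)) -rmorphB norm_real_complex lecR.
have qnumE n : complex.Re `|qnum lq 1 (c%:R * (n%:R + y))| =
    complex.Re `|1 - w n| * (complex.Re `|1 - cexp lq|)^-1.
  rewrite /qnum !mul1r /qpow mul1r normrM normfV.
  rewrite (norm_complexE (1 - cexp lq)) (norm_complexE (1 - w n)).
  by rewrite -fmorphV -rmorphM /=.
rewrite (funext qnumE).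
have := cvgMr_tmp (FF := eventually_filter)
  (b := (complex.Re `|1 - cexp lq|)^-1) w1.
by rewrite mul1r.
Unshelve. all: by end_near. Qed.

(** Geometric domination of the terms of the zeta series, with ratio t = |q|^c;
    the constant K absorbs the bounded exponents of the inverse powers. *)
Lemma qEuler_term_le (R : realType) (lq s : R[i]) (c : nat) (y : R) :
  `|cexp lq| < 1 -> (0 < c)%N ->
  exists K t : R, 0 <= t < 1 /\ forall n,
    `|(- qpow lq c%:R) ^+ n / qnum_pow lq c (n%:R + y) s| <= (K * t ^+ n)%:C.
Proof.
move=> q1 c0; have lq0 := Re_log_lt0 q1.
have N0 : 0 < complex.Re `|1 - cexp lq|.
  rewrite -ltcR -norm_complexE normr_gt0 subr_eq0.
  by apply: contraTneq q1 => <-; rewrite normr1 ltxx.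
have N0' : 0 < (complex.Re `|1 - cexp lq|)^-1 by rewrite invr_gt0.
have [B logB] := cLog_bounded N0' (qnum_norm_cvg y q1 c0).
have [L normL] : exists L : R, `|cLog (qnum lq 1 c%:R)| = L%:C.
  by eexists; exact: norm_complexE.
have [S normS] : exists S : R, `|s| = S%:C.
  by eexists; exact: norm_complexE.
exists (expR (S * (B + L))), (expR (c%:R * complex.Re lq)); split.
  by rewrite expR_ge0 expR_lt1 pmulr_rlt0 ?ltr0n.
move=> n; rewrite normrM normrX normrN norm_qpow -rmorphXn mulrC rmorphM /=.
rewrite ler_wpM2r ?ler0c ?exprn_ge0 ?expR_ge0// norm_cexpV_le//.
rewrite normrM rmorphM /= -normS ler_wpM2l//.
by rewrite (le_trans (ler_normB _ _))// rmorphD /= -normL lerD.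
Qed.

(** * The symmetric form of the two sides *)

(** Clearing denominators in the q-number: a (M + bx + (b/a) J) equals
    aM + bJ + abx, and q^(aM+bJ) carries the sign (-1)^(aM+bJ) = (-1)^(M+J)
    because a and b are odd. *)
Lemma qEuler_term_scale (R : realType) (lq s : R[i]) (a b M J : nat) (x : R) :
  odd a -> odd b ->
  cpow (qnum lq 1 b%:R) s * ((-1) ^+ J * cexp lq ^+ (b * J) *
    ((- qpow lq a%:R) ^+ M
       / qnum_pow lq a (M%:R + (b%:R * x + b%:R / a%:R * J%:R)) s)) =
  cpow (qnum lq 1 a%:R) s * cpow (qnum lq 1 b%:R) s *
    ((- cexp lq) ^+ (a * M + b * J)
       / cpow (qnum lq 1 ((a * M + b * J)%:R + a%:R * b%:R * x)) s).
Proof.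
move=> oa ob; have a0 : a%:R != 0 :> R by rewrite pnatr_eq0; case: a oa.
have -> : qnum_pow lq a (M%:R + (b%:R * x + b%:R / a%:R * J%:R)) s =
    cpow (qnum lq 1 ((a * M + b * J)%:R + a%:R * b%:R * x)) s
      / cpow (qnum lq 1 a%:R) s.
  rewrite /qnum_pow (_ : a%:R * _ = (a * M + b * J)%:R + a%:R * b%:R * x).
    by rewrite mulrBr cexpD cexpN.
  by rewrite natrD !natrM; field.
have -> : (- cexp lq) ^+ (a * M + b * J) =
    (- qpow lq a%:R) ^+ M * ((-1) ^+ J * cexp lq ^+ (b * J)).
  rewrite exprD !exprM [(- cexp lq) ^+ a]exprNn [(- cexp lq) ^+ b]exprNn.
  rewrite -(signr_odd _ a) -(signr_odd _ b) oa ob expr1 !mulN1r [X in _ * X]exprNn.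
  by rewrite qpow_nat.
rewrite invfM invrK; ring.
Qed.

(** One side of the identity as a limit of sums over cubes.  The prefactor and
    the function of N that is summed are symmetric in a and b, so exchanging a
    and b affects only the ranges and the weights of m and j in N.  The side bk
    of the cube is harmless for the limit and makes both sides comparable for
    each k. *)
Lemma qEuler_side_cvg (R : realType) (lq s : R[i]) (r a b : nat) (x : R) :
  `|cexp lq| < 1 -> odd a -> odd b ->
  (qnum lq a 2 ^+ r * qnum lq b 2 ^+ r *
    (cpow (qnum lq 1 a%:R) s * cpow (qnum lq 1 b%:R) s *
    \sum_(j : {ffun 'I_r -> 'I_a}) \sum_(m : {ffun 'I_r -> 'I_(b * k)})
      let N := (a * \sum_(l < r) m l + b * \sum_(l < r) j l)%N in
      (- cexp lq) ^+ N / cpow (qnum lq 1 (N%:R + a%:R * b%:R * x)) s)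
    : R[i]^o) @[k --> \oo] -->
  (qnum lq b 2 ^+ r * cpow (qnum lq 1 b%:R) s *
    (\sum_(j : {ffun 'I_r -> 'I_a})
       (-1) ^+ (\sum_(l < r) j l)%N * cexp lq ^+ (b * \sum_(l < r) j l)%N *
       qEuler_zeta lq a r s
         (b%:R * x + b%:R / a%:R * (\sum_(l < r) j l)%N%:R)) : R[i]^o).
Proof.
move=> q1 oa ob.
have [a0 b0] := (odd_gt0 oa, odd_gt0 ob).
have cvg_bk : (b * k)%N @[k --> \oo] --> \oo.
  exact: cvg_mulnl.
pose y (j : {ffun 'I_r -> 'I_a}) : R :=
  b%:R * x + b%:R / a%:R * (\sum_(l < r) j l)%N%:R.
pose h j n : R[i] :=
  (- qpow lq a%:R) ^+ n / qnum_pow lq a (n%:R + y j) s.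
pose e (j : {ffun 'I_r -> 'I_a}) : R[i] :=
  (-1) ^+ (\sum_(l < r) j l)%N * cexp lq ^+ (b * \sum_(l < r) j l)%N.
have cvg_zeta j : (e j * (qnum lq a 2 ^+ r *
     \sum_(m : {ffun 'I_r -> 'I_(b * k)}) h j (\sum_(l < r) m l)%N) : R[i]^o)
     @[k --> \oo] --> (e j * qEuler_zeta lq a r s (y j) : R[i]^o).
  have [K [t [t01 hK]]] := qEuler_term_le s (y j) q1 a0.
  apply: cvgMl_tmp; apply: cvgMl_tmp.
  exact: cvg_comp cvg_bk (cvg_cube_sum (r := r) t01 hK).
have cvg_side : ((\sum_j e j * (qnum lq a 2 ^+ r *
     \sum_(m : {ffun 'I_r -> 'I_(b * k)}) h j (\sum_(l < r) m l)%N)) : R[i]^o)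
     @[k --> \oo] --> ((\sum_j e j * qEuler_zeta lq a r s (y j)) : R[i]^o).
  by apply: cvg_big => [|j _]; [exact: add_continuous|exact: cvg_zeta].
have := cvgMl_tmp (FF := eventually_filter)
  (a := qnum lq b 2 ^+ r * cpow (qnum lq 1 b%:R) s) cvg_side.
apply: cvg_trans; apply: near_eq_cvg; apply: nearW => k.
set p := cpow _ s; set p' := cpow _ s; set A := _ ^+ r; set B := _ ^+ r.
rewrite mulr_sumr /=.
transitivity (\sum_j \sum_(m : {ffun 'I_r -> 'I_(b * k)})
   A * B * (p * (e j * h j (\sum_(l < r) m l)%N))).
  apply: eq_bigr => j _; rewrite !mulr_sumr.
  by apply: eq_bigr => m _; ring.
rewrite !mulr_sumr; apply: eq_bigr => j _; rewrite !mulr_sumr.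
apply: eq_bigr => m _.
by rewrite qEuler_term_scale// [A * B]mulrC.
Qed.

Theorem theorem1 (R : realType) (q lq : R[i]) (hq0 : 0 < `|q|) (hq1 : `|q| < 1)
  (hlq : cexp lq = q) (r : nat) (hr : (0 < r)%N) (s : R[i])
  (a b : nat) (ha : a = 1 %[mod 2]) (hb : b = 1 %[mod 2]) (x : R)
  (hxa : forall (j : {ffun 'I_r -> 'I_a}) (n : nat),
     b%:R * x + b%:R / a%:R * (\sum_(l < r) j l)%N%:R <> - n%:R)
  (hxb : forall (j : {ffun 'I_r -> 'I_b}) (n : nat),
     a%:R * x + a%:R / b%:R * (\sum_(l < r) j l)%N%:R <> - n%:R) :
  qnum lq b 2 ^+ r * cpow (qnum lq 1 b%:R) s *
    (\sum_(j : {ffun 'I_r -> 'I_a})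
       (-1) ^+ (\sum_(l < r) j l)%N * q ^+ (b * \sum_(l < r) j l)%N *
       qEuler_zeta lq a r s
         (b%:R * x + b%:R / a%:R * (\sum_(l < r) j l)%N%:R))
  = qnum lq a 2 ^+ r * cpow (qnum lq 1 a%:R) s *
    (\sum_(j : {ffun 'I_r -> 'I_b})
       (-1) ^+ (\sum_(l < r) j l)%N * q ^+ (a * \sum_(l < r) j l)%N *
       qEuler_zeta lq b r s
         (a%:R * x + a%:R / b%:R * (\sum_(l < r) j l)%N%:R)).
Proof.
move: hq1; rewrite -hlq => q1.
have odd_of_mod n : n = 1 %[mod 2] -> odd n.
  by rewrite !modn2; case: (odd n).
have [oa ob] := (odd_of_mod _ ha, odd_of_mod _ hb).
have [a0 b0] := (odd_gt0 oa, odd_gt0 ob).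
apply: (cvg_unique (@norm_hausdorff _ (R[i])^o)
  (qEuler_side_cvg (s := s) (r := r) (x := x) q1 oa ob)).
apply: cvg_trans (qEuler_side_cvg (s := s) (r := r) (x := x) q1 ob oa).
apply: near_eq_cvg; apply: nearW => k /=.
rewrite [qnum lq b 2 ^+ r * _]mulrC [cpow (qnum lq 1 b%:R) s * _]mulrC.
congr (_ * (_ * _)).
rewrite [b%:R * a%:R]mulrC.
exact: (cube_sum_symmetric r k (fun N => (- cexp lq) ^+ N /
  cpow (qnum lq 1 (N%:R + a%:R * b%:R * x)) s)).
Qed.
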